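(* Let $\lambda$ be a partition whose conjugate, in frequency notation, is $\lambda'=\langle t_1^{m_1}, \dots, t_k^{m_k} \rangle$ (i.e. $\lambda'$ has exactly $m_i$ parts equal to $t_i$), with $t_1 > \cdots > t_k > 0$ and $m_i>0$ for all $i$. Let $M = \sum_{i=1}^k m_i$. Then for every integer $\Delta$ with $0\le\Delta< t_k$, \[ w^{\Delta}_\lambda \geq p_{2(M-1)} (\Delta) \binom M {m_1,\dots,m_k}. \]
   Context: For a permutation $\pi=(\pi_1,\dots,\pi_n)\in S_n$ (one-line notation), its inversion number is $\mathrm{inv}(\pi)=\#\{i<j:\pi_i>\pi_j\}$. The shape $\mathrm{sh}(\pi)$ of $\pi$ is the common shape of the insertion and recording tableaux associated to $\pi$ by the Robinson–Schensted correspondence. For a partition $\lambda\vdash n$, $\lambda'$ denotes its conjugate, $W_\lambda$ is the set of permutations of shape $\lambda$, and for $\Delta\ge 0$, $W_\lambda^\Delta$ is the set of $\pi\in W_\lambda$ whose inversion number exceeds the minimum of $\mathrm{inv}$ over $W_\lambda$ by exactly $\Delta$; $w_\lambda^\Delta=\#W_\lambda^\Delta$. For $c\ge 1$, $p_c(m)$ denotes the number of partitions of $m$ into parts of $c$ colours, i.e. $\sum_{m\ge0}p_c(m)x^m=\prod_{j\ge1}(1-x^j)^{-c}$. $\binom{M}{m_1,\dots,m_k}$ is the multinomial coefficient. *)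

(* Defs.v *)
From mathcomp Require Import all_boot perm.

Set Implicit Arguments.
Unset Strict Implicit.
Unset Printing Implicit Defensive.

Definition is_partition (la : seq nat) (n : nat) : bool :=
  [&& sorted geq la, 0 \notin la & sumn la == n].

Definition conj_partition (la : seq nat) : seq nat :=
  [seq count (fun p => j < p) la | j <- iota 0 (head 0 la)].

(* Frequency notation <t_0^{m_0}, ..., t_k^{m_k}>. *)
Definition freq_partition k (t m : 'I_k -> nat) : seq nat :=
  flatten [seq nseq (m i) (t i) | i <- enum 'I_k].

(* A tableau is the list of its rows, longest first.  Row insertion of x in r
   replaces the first entry exceeding x, at position [bump_pos r x]; that
   position is [size r] when x is appended at the end of r. *)
Definition bump_pos (r : seq nat) (x : nat) : nat := find (fun y => x < y) r.

Fixpoint row_insert (P : seq (seq nat)) (x : nat) : seq (seq nat) :=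
  if P is r :: P' then
    let p := bump_pos r x in
    set_nth x r p x
      :: (if p < size r then row_insert P' (nth x r p) else P')
  else [:: [:: x]].

(* Index of the row in which [row_insert P x] has its new cell. *)
Fixpoint new_cell_row (P : seq (seq nat)) (x : nat) : nat :=
  if P is r :: P' then
    let p := bump_pos r x in
    if p < size r then (new_cell_row P' (nth x r p)).+1 else 0
  else 0.

Definition rs_step (PQ : seq (seq nat) * seq (seq nat)) (x : nat) :=
  let: (P, Q) := PQ in
  let i := new_cell_row P x in
  (row_insert P x,
   set_nth [::] Q i (rcons (nth [::] Q i) (sumn (shape P)).+1)).

Definition robinson_schensted (w : seq nat) : seq (seq nat) * seq (seq nat) :=
  foldl rs_step ([::], [::]) w.

(* One-line notation, with values in {0, ..., n-1}. *)
Definition one_line n (s : 'S_n) : seq nat := [seq val (s i) | i <- enum 'I_n].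

Definition insertion_tableau n (s : 'S_n) := (robinson_schensted (one_line s)).1.
Definition recording_tableau n (s : 'S_n) := (robinson_schensted (one_line s)).2.

Definition sh n (s : 'S_n) : seq nat := shape (insertion_tableau s).

Lemma shape_row_insert P x :
  shape (row_insert P x) = incr_nth (shape P) (new_cell_row P x).
Proof.
elim: P x => [|r P IH] x //=; rewrite size_set_nth.
have le_p : bump_pos r x <= size r by exact: find_size.
case: ltnP => [lt_p|ge_p] /=; first by rewrite IH (maxn_idPr lt_p).
have -> : bump_pos r x = size r by apply/eqP; rewrite eqn_leq le_p.
by rewrite (maxn_idPl (leqnSn _)).
Qed.

Lemma shape_rs_step P Q x : shape P = shape Q ->
  shape (rs_step (P, Q) x).1 = shape (rs_step (P, Q) x).2.
Proof.
move=> ePQ; rewrite /= shape_row_insert ePQ.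
elim: Q (new_cell_row P x) (_.+1) {ePQ} => [|q Q IH] [|i] l //=.
- by congr (_ :: _); elim: i => [|i IHi] //=; rewrite IHi.
- by rewrite size_rcons.
- by rewrite (IH i l).
Qed.

Lemma sh_recording n (s : 'S_n) : sh s = shape (recording_tableau s).
Proof.
rewrite /sh /insertion_tableau /recording_tableau /robinson_schensted.
suff: forall w PQ, shape PQ.1 = shape PQ.2 ->
  shape (foldl rs_step PQ w).1 = shape (foldl rs_step PQ w).2 by apply.
elim=> [|x w IH] [P Q] //= ePQ; apply: IH.
exact: (shape_rs_step x ePQ).
Qed.

Definition inv n (s : 'S_n) : nat :=
  #|[set p : 'I_n * 'I_n | (p.1 < p.2) && (s p.2 < s p.1)]|.

Definition W n (la : seq nat) : {set 'S_n} := [set s | sh s == la].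

(* u ranges over the minimizers of [inv] on [W n la]. *)
Definition Wdelta n (la : seq nat) (Delta : nat) : {set 'S_n} :=
  [set s in W n la |
    [exists u in W n la,
      [forall v in W n la, inv u <= inv v] && (inv s == inv u + Delta)]].

(* A partition of N in c colours is given by the multiplicity f (a, j) of the
   part j.+1 with colour a; parts and multiplicities are at most N.  For c = 0
   this gives 1 if N = 0 and 0 otherwise, as does the generating function
   prod_(j >= 1) (1 - x^j)^(-c). *)
Definition coloured_partitions (c N : nat) : nat :=
  #|[set f : {ffun 'I_c * 'I_N -> 'I_N.+1} | \sum_(x : 'I_c * 'I_N) x.2.+1 * f x == N]|.

Definition multinomial k (m : 'I_k -> nat) : nat :=
  (\sum_i m i)`! %/ \prod_i (m i)`!.

(* Main.v *)
Require Import Defs.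
From mathcomp Require Import all_boot perm zify.

(* Let the columns of la, taken in any order, have lengths c_0, ..., c_(M-1).
   Give every position and every value of a permutation a label i < M, each i
   being used c_i times, so that equal labels form a decreasing subsequence.
   The label words U (by position) and V (by value) determine the permutation.
   If inv U + inv V < min c_i, two blocks never interfere enough to disturb row
   insertion: a letter of block i always bumps a letter of block i, so row j of
   the insertion tableau holds one letter of each block of which more than j
   letters have been inserted.  Hence the shape is la, the positions of bumping
   in the first row are the labels, so that the permutation determines U and V,
   and the inversion number is sum_i 'C(c_i, 2) + inv U + inv V.
   The constant sum_i 'C(c_i, 2) is the minimum over W_la: inserting x creates a
   cell in row r after bumping r earlier letters, all larger than x, so the
   inversion number is at least the sum of the rows of the cells.
   Finally, words with content c and few inversions are given by M - 1
   partitions: the i-th one tells how many letters i > 0 have exactly j smaller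
   letters to their right. *)

Set Implicit Arguments.
Unset Strict Implicit.
Unset Printing Implicit Defensive.

(** * Inversions of words and the lower bound *)

Fixpoint invs (s : seq nat) : nat :=
  if s is x :: s' then count (gtn x) s' + invs s' else 0.

Lemma invs_cat s1 s2 :
  invs (s1 ++ s2) = invs s1 + invs s2 + \sum_(x <- s1) count (gtn x) s2.
Proof.
elim: s1 => [|x s1 IH] /=; first by rewrite big_nil addn0.
by rewrite count_cat IH big_cons; lia.
Qed.

(** This bound turns any misplacement of two blocks into many inversions of a label word. *)
Lemma leq_invs k i i' s : i' < i ->
  count_mem i (take k s) * count_mem i' (drop k s) <= invs s.
Proof.
move=> lt_i; rewrite -{3}(cat_take_drop k s) invs_cat.
apply: leq_trans (leq_addl _ _).
elim: (take k s) => [|x s1 IH] //=; rewrite big_cons mulnDl leq_add //.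
case: eqP => [->|_]; rewrite ?mul1n ?mul0n //.
by apply: sub_count => y /= /eqP->.
Qed.

Lemma invs_sum n s : size s = n ->
  invs s = \sum_(i < n) \sum_(j < n)
    ((i < j) && (nth 0 s j < nth 0 s i) : nat).
Proof.
move=> <-; elim: s {n} => [|x s IH] /=; first by rewrite big_ord0.
rewrite big_ord_recl big_ord_recl /= add0n; congr (_ + _).
  by elim: s {IH} => [|y s IH]; rewrite ?big_ord0 // big_ord_recl /= IH.
rewrite IH; apply: eq_bigr => i _; rewrite big_ord_recl /= add0n.
by apply: eq_bigr => j _; rewrite /bump /= !add1n ltnS.
Qed.

Lemma inv_sum n (s : 'S_n) :
  Defs.inv s = \sum_(i < n) \sum_(j < n) ((i < j) && (s j < s i) : nat).
Proof.
rewrite /Defs.inv pair_big /= -sum1_card big_mkcond /=.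
by apply: eq_bigr => -[i j] _; rewrite inE /=; case: (_ && _).
Qed.

Lemma size_one_line n (s : 'S_n) : size (one_line s) = n.
Proof. by rewrite size_map size_enum_ord. Qed.

Lemma nth_one_line n (s : 'S_n) (i : 'I_n) : nth 0 (one_line s) i = s i.
Proof. by rewrite (nth_map i) ?size_enum_ord // nth_ord_enum. Qed.

Lemma inv_one_line n (s : 'S_n) : Defs.inv s = invs (one_line s).
Proof.
rewrite inv_sum (invs_sum (size_one_line s)).
by apply: eq_bigr => i _; apply: eq_bigr => j _; rewrite !nth_one_line.
Qed.

Definition insert_all (w : seq nat) : seq (seq nat) := foldl row_insert [::] w.

Lemma robinson_schensted1 w : (robinson_schensted w).1 = insert_all w.
Proof.
rewrite /robinson_schensted /insert_all.
have : ([::] : seq (seq nat)) = ([::] : seq (seq nat), [::] : seq (seq nat)).1 by [].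
move: ([::], [::]) => PQ -> .
elim: w PQ => [|x w IH] [P Q] //=; exact: IH.
Qed.

Lemma insert_all_rcons w x :
  insert_all (rcons w x) = row_insert (insert_all w) x.
Proof. by rewrite /insert_all -cats1 foldl_cat. Qed.

Lemma perm_row_insert P x :
  perm_eq (flatten (row_insert P x)) (x :: flatten P).
Proof.
elim: P x => [|r P IH] x //=.
set p := bump_pos r x; have le_p : p <= size r by exact: find_size.
apply/seq.permP => a; case: ltnP => [lt_p|ge_p] /=.
  rewrite set_nthE lt_p !count_cat /= (seq.permP (IH _)) /=.
  have := count_cat a (take p r) (drop p r).
  rewrite cat_take_drop (drop_nth x lt_p) /= => ->; lia.
have -> : p = size r by lia.
rewrite set_nthE ltnn subnn /= !count_cat /=; lia.
Qed.

Lemma perm_insert_all w : perm_eq (flatten (insert_all w)) w.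
Proof.
elim/last_ind: w => [|w x IH] //; apply/seq.permP => a.
by rewrite insert_all_rcons (seq.permP (perm_row_insert _ _)) -cats1 count_cat /=
  (seq.permP IH) addn0 addnC.
Qed.

(** The letters bumped on the way down increase strictly from [x], one per row above the new
    cell. *)
Lemma new_cell_row_le P x : new_cell_row P x <= count (ltn x) (flatten P).
Proof.
elim: P x => [|r P IH] x //=; rewrite count_cat.
case: ltnP => // lt_p; set y := nth x r _.
have hr : has (fun y => x < y) r by rewrite has_find.
have lt_xy : x < y by exact: nth_find.
rewrite -add1n leq_add -?has_count //.
apply: leq_trans (IH y) _; apply: sub_count => z /=; lia.
Qed.

(** The statistic usually written n(lambda): the sum of the row indices of the cells. *)
Definition weight (sh : seq nat) : nat := \sum_(j < size sh) j * nth 0 sh j.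

Lemma weightE sh N : size sh <= N -> weight sh = \sum_(j < N) j * nth 0 sh j.
Proof.
move=> le_N; rewrite /weight.
rewrite (big_ord_widen N (fun j => j * nth 0 sh j) le_N) big_mkcond /=.
apply: eq_bigr => j _; case: ltnP => // le_j; by rewrite nth_default ?muln0.
Qed.

Lemma weight_incr_nth sh i : weight (incr_nth sh i) = weight sh + i.
Proof.
pose N := maxn (size sh) (size (incr_nth sh i)).
have lt_i : i < N.
  rewrite /N size_incr_nth leq_max.
  by case: (ltnP i (size sh)) => // _; rewrite ltnSn orbT.
rewrite (@weightE _ N) ?leq_maxr // (@weightE sh N) ?leq_maxl //.
rewrite (bigD1 (Ordinal lt_i)) //= [in RHS](bigD1 (Ordinal lt_i)) //=.
rewrite nth_incr_nth eqxx add1n mulnS.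
rewrite [in LHS](eq_bigr (fun j : 'I_N => j * nth 0 sh j)).
  by rewrite [RHS]addnC addnA.
move=> j; rewrite -val_eqE /= nth_incr_nth eq_sym => /negPf->; by rewrite add0n.
Qed.

Lemma invs_rcons s x : invs (rcons s x) = invs s + count (ltn x) s.
Proof.
rewrite -cats1 invs_cat /= !addn0; congr (_ + _).
by elim: s => [|y s IH]; rewrite ?big_nil // big_cons IH addn0.
Qed.

Lemma weight_le_invs w : weight (shape (insert_all w)) <= invs w.
Proof.
elim/last_ind: w => [|w x IH]; first by rewrite /weight big_ord0.
rewrite insert_all_rcons shape_row_insert weight_incr_nth invs_rcons leq_add //.
by rewrite -(seq.permP (perm_insert_all w)) new_cell_row_le.
Qed.

(** * Row insertion of a labelled word *)

Lemma filter_iota0 (p : pred nat) a b :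
  (forall x, a <= x < a + b -> ~~ p x) -> [seq x <- iota a b | p x] = [::].
Proof.
move=> p0; apply/eqP; rewrite -[_ == _]negbK -has_filter; apply/hasPn => x.
by rewrite mem_iota; apply: p0.
Qed.

Section Blocks.

Variable M : nat.

(* Row [j] of the tableau once the first [s i] letters of each block [i] have
   been inserted; [letter i r] is the [r]-th letter of block [i]. *)
Definition block_row (letter : nat -> nat -> nat) (s : nat -> nat) (j : nat) :=
  [seq letter i (s i - j.+1) | i <- iota 0 M & j < s i].

Lemma block_row_split letter s j i : i < M ->
  block_row letter s j =
    [seq letter i' (s i' - j.+1) | i' <- iota 0 i & j < s i']
    ++ (if j < s i then [:: letter i (s i - j.+1)] else [::])
    ++ [seq letter i' (s i' - j.+1) | i' <- iota i.+1 (M - i.+1) & j < s i'].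
Proof.
move=> lt_i; rewrite /block_row.
have -> : M = i + (M - i.+1).+1 by lia.
rewrite iotaD add0n /= filter_cat map_cat /=.
have -> : i + (M - i.+1).+1 - i.+1 = M - i.+1 by lia.
by case: ifP.
Qed.

Lemma bump_pos_cat r1 r2 x : all (ltn^~ x) r1 ->
  bump_pos (r1 ++ r2) x = size r1 + bump_pos r2 x.
Proof.
move=> /allP r1x; rewrite /bump_pos find_cat ifN //; apply/hasPn => y /r1x /=.
by rewrite -leqNgt => /ltnW.
Qed.

Definition add_letter (s : nat -> nat) (i i' : nat) : nat :=
  if i' == i then (s i').+1 else s i'.

Variables (letter : nat -> nat -> nat) (s : nat -> nat) (i : nat).
Hypothesis lt_i : i < M.
(** The letter reaching row [j] is [letter i (s i - j)]: the new letter for [j = 0], then the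
    letters of block [i] pushed out of the rows above. *)
Hypothesis val_lt : forall i' j, i' < i -> j < s i' -> j <= s i ->
  letter i' (s i' - j.+1) < letter i (s i - j).
Hypothesis s_le : forall i', i < i' < M -> s i' <= s i.
Hypothesis val_gt : forall j, j < s i -> letter i (s i - j) < letter i (s i - j.+1).

Let s' := add_letter s i.

Lemma block_row_add j : block_row letter s' j =
  if j <= s i then
    [seq letter i' (s i' - j.+1) | i' <- iota 0 i & j < s i']
    ++ [:: letter i (s i - j)]
    ++ [seq letter i' (s i' - j.+1) | i' <- iota i.+1 (M - i.+1) & j < s i']
  else block_row letter s j.
Proof.
have e0 : forall a b, (i < a) || (a + b <= i) ->
    [seq letter i' (s' i' - j.+1) | i' <- iota a b & j < s' i'] =
    [seq letter i' (s i' - j.+1) | i' <- iota a b & j < s i'].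
  move=> a b hab.
  have es : {in iota a b, s' =1 s}.
    move=> i'; rewrite mem_iota /s' /add_letter => hi'.
    by rewrite ifN //; lia.
  have -> : [seq i' <- iota a b | j < s' i'] = [seq i' <- iota a b | j < s i'].
    by apply: eq_in_filter => i' /es->.
  by apply/eq_in_map => i'; rewrite mem_filter => /andP[_ /es->].
rewrite !(block_row_split _ _ _ lt_i) !e0 ?add0n ?leqnn ?ltnSn ?orbT //.
rewrite {1 2}/s' /add_letter eqxx ltnS subSS; case: ltngtP => //.
Qed.

(** Entries of earlier blocks are smaller than the incoming letter, and the entry of block [i] is
    larger. If block [i] has no entry in the row, neither has a later block, by [s_le], and the
    letter is appended. *)
Lemma bump_pos_block_row j : j <= s i ->
  bump_pos (block_row letter s j) (letter i (s i - j))
    = count (fun i' => j < s i') (iota 0 i).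
Proof.
move=> le_j; rewrite (block_row_split _ _ _ lt_i) bump_pos_cat.
  rewrite size_map size_filter; case: ltnP => [lt_j|ge_j] /=.
    by rewrite /bump_pos /= val_gt // addn0.
  rewrite filter_iota0 ?addn0 // => i' hi'.
  by rewrite -leqNgt (leq_trans (s_le _)) //; lia.
apply/allP => _ /mapP[i' + ->]; rewrite mem_filter mem_iota /= => /andP[h1 h2].
by rewrite val_lt.
Qed.

(** The letter displaced from row [j] is [letter i (s i - j.+1)], the one expected in row [j.+1];
    the insertion runs down block [i] and adds a cell in row [s i]. *)
Lemma row_insert_block j h : j <= s i ->
  (forall i', i' < M -> s i' <= j + h) ->
  row_insert [seq block_row letter s j' | j' <- iota j h] (letter i (s i - j))
  = [seq block_row letter s' j' | j' <- iota j (maxn h (s i - j).+1)].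
Proof.
elim: h j => [|h IH] j le_j le_s /=.
  have e : s i = j by apply/eqP; rewrite eqn_leq le_j -[j]addn0 le_s.
  rewrite e subnn /= block_row_add e leqnn subnn.
  by rewrite !filter_iota0 // => i' hi'; rewrite -leqNgt -[j]addn0 le_s //; lia.
rewrite bump_pos_block_row // maxnSS /=.
pose l := [seq letter i' (s i' - j.+1) | i' <- iota 0 i & j < s i'].
have el : count (fun i' => j < s i') (iota 0 i) = size l.
  by rewrite size_map size_filter.
rewrite el block_row_add le_j (block_row_split _ _ _ lt_i) -/l.
have set_l : forall r x, set_nth x (l ++ r) (size l) x = l ++ set_nth x r 0 x.
  by move=> r x; elim: l {el} => //= y l ->.
rewrite set_l size_cat nth_cat ltnn subnn.
case: (ltnP j (s i)) => [lt_j|ge_j] /=.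
  rewrite addnS ltnS leq_addr IH //.
    by congr (_ :: map _ (iota _ (maxn _ _))); lia.
  by move=> i' /le_s; rewrite addSnnS.
have e : s i = j by apply/eqP; rewrite eqn_leq le_j ge_j.
rewrite filter_iota0 ?addn0 /=; last first.
  by move=> i' hi'; rewrite -leqNgt (leq_trans (s_le _)) //; lia.
rewrite ltnn e subnn maxn0; congr (_ :: _).
apply/eq_in_map => j'; rewrite mem_iota => hj'.
by rewrite block_row_add ifN //; lia.
Qed.

End Blocks.

Lemma eq_block_row M letter s s' : s =1 s' -> block_row M letter s =1 block_row M letter s'.
Proof.
move=> es j; rewrite /block_row.
under eq_filter do rewrite es.
by apply: eq_map => i; rewrite es.
Qed.

Lemma sorted_count_le l r : sorted gtn l ->
  size l - r <= count (leq^~ (nth 0 l r)) l.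
Proof.
have gt_trans : transitive gtn by move=> x y z /=; lia.
elim: l r => [|x l IH] [|r] //= path_l.
  rewrite leqnn add1n ltnS; have /allP := order_path_min gt_trans path_l.
  move=> lt_x; rewrite -(count_predT l) -size_filter -[leqRHS]size_filter.
  rewrite !size_filter; apply/eq_leq/eq_in_count => y /lt_x /= /ltnW ->.
  by [].
by rewrite subSS (leq_trans (IH r _)) ?leq_addl // (path_sorted path_l).
Qed.

Lemma sorted_count_gt l r y : sorted gtn l -> r < size l -> y < nth 0 l r ->
  r < count (ltn y) l.
Proof.
have gt_trans : transitive gtn by move=> x z t /=; lia.
elim: l r => [|x l IH] [|r] //= path_l; first by move=> _ ->.
rewrite ltnS => lt_r lt_y.
have /allP/(_ _ (mem_nth 0 lt_r)) /= := order_path_min gt_trans path_l.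
move=> /(ltn_trans lt_y) ->.
by rewrite add1n ltnS IH // (path_sorted path_l).
Qed.

Lemma sum_eq_pairs M s : {in s, forall x, x < M} ->
  \sum_(i < size s) \sum_(j < size s) ((i < j) && (nth 0 s i == nth 0 s j) : nat)
  = \sum_(k < M) 'C(count_mem (k : nat) s, 2).
Proof.
elim: s => [|x s IH] lt_M /=.
  by rewrite big_ord0 big1.
rewrite big_ord_recl big_ord_recl /= add0n.
transitivity (count_mem x s + \sum_(k < M) 'C(count_mem (k : nat) s, 2)).
  congr (_ + _).
    elim: s {IH lt_M} => [|y s IH]; rewrite ?big_ord0 // big_ord_recl /= IH.
    by rewrite eq_sym.
  rewrite -IH => [|y y_s]; last by rewrite lt_M // inE y_s orbT.
  apply: eq_bigr => i _; rewrite big_ord_recl /= add0n.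
  by apply: eq_bigr => j _; rewrite /bump /= !add1n ltnS.
have lt_x : x < M by rewrite lt_M ?inE ?eqxx.
rewrite (bigD1 (Ordinal lt_x)) //= [RHS](bigD1 (Ordinal lt_x)) //= eqxx add1n.
rewrite binS bin1 addnA; congr (_ + _); first by rewrite addnC.
apply: eq_bigr => k; rewrite -val_eqE /= eq_sym => /negPf->.
by [].
Qed.

(** * Labelled words with few label inversions *)

Section LabelledWord.

Variables (M : nat) (lab : nat -> nat) (w : seq nat).

Definition block i := [seq x <- w | lab x == i].

Definition letter i r := nth 0 (block i) r.

Definition prefix_count p i := count (fun x => lab x == i) (take p w).

Let n := size w.
Let u := [seq lab x | x <- w].
Let v := [seq lab x | x <- iota 0 n].

Hypothesis w_perm : perm_eq w (iota 0 n).
Hypothesis lab_lt : forall x, x \in w -> lab x < M.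
Hypothesis block_sorted : forall i, sorted gtn (block i).
Hypothesis few_invs : forall i, i < M -> invs u + invs v < size (block i).

Lemma size_block i : size (block i) = count (fun x => lab x == i) w.
Proof. exact: size_filter. Qed.

Lemma count_take_v b i : b <= n ->
  count_mem i (take b v) = count (gtn b) (block i).
Proof.
move=> le_b; rewrite -map_take take_iota (minn_idPl le_b) count_map count_filter.
rewrite (seq.permP w_perm) -[in RHS](subnKC le_b) iotaD count_cat add0n.
rewrite [X in _ = _ + X](_ : _ = 0) ?addn0; last first.
  apply/eqP; rewrite -leqn0 leqNgt -has_count; apply/hasPn => x /=.
  by rewrite mem_iota; lia.
by apply: eq_in_count => x; rewrite mem_iota /= add0n => ->.
Qed.

Lemma count_drop_v b i : b <= n ->
  count_mem i (drop b v) = count (leq b) (block i).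
Proof.
move=> le_b; have := count_cat (pred1 i) (take b v) (drop b v).
rewrite cat_take_drop count_take_v // /v count_map -(seq.permP w_perm).
rewrite -size_block -(count_predC (gtn b)) => /addnI <-.
by apply: eq_count => x /=; rewrite -leqNgt.
Qed.

Lemma leq_invs_u p i i' : i' < i ->
  prefix_count p i * (size (block i') - prefix_count p i') <= invs u.
Proof.
move=> lt_i; apply: leq_trans (leq_invs p u lt_i).
have := count_cat (fun x => lab x == i') (take p w) (drop p w).
rewrite cat_take_drop size_block => ->; rewrite addKn.
by rewrite /u -map_take -map_drop !count_map.
Qed.

(** As blocks decrease, at least [size (block i) - r] letters of block [i] are at most [letter i r],
    and more than [r'] letters of block [i'] exceed it. *)
Lemma leq_invs_v i i' r r' : i' < i -> r < size (block i) -> r' < size (block i') ->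
  letter i r < letter i' r' -> (size (block i) - r) * r'.+1 <= invs v.
Proof.
move=> lt_i lt_r lt_r' lt_val.
have : letter i r \in w.
  by have := mem_nth 0 lt_r; rewrite mem_filter => /andP[].
rewrite (perm_mem w_perm) mem_iota add0n => /andP[_ lt_n].
apply: leq_trans (leq_invs (letter i r).+1 v lt_i).
rewrite count_take_v // count_drop_v // leq_mul //.
  exact: sorted_count_le.
exact: sorted_count_gt.
Qed.

Section Step.

Variable p : nat.
Hypothesis lt_p : p < n.
Let x := nth 0 w p.
Let i := lab x.
Let s := prefix_count p.

Lemma prefix_count_succ : prefix_count p.+1 =1 add_letter s i.
Proof.
move=> i'; rewrite /prefix_count (take_nth 0) // -cats1 count_cat /= addn0.
rewrite /add_letter /s /prefix_count /i /x eq_sym.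
by case: eqP; rewrite ?addn1 ?addn0.
Qed.

Lemma leq_prefix_count q i' : prefix_count q i' <= size (block i').
Proof.
have := count_cat (fun y => lab y == i') (take q w) (drop q w).
by rewrite cat_take_drop size_block => ->; rewrite leq_addr.
Qed.

Lemma val_prefix_count : letter i (s i) = x.
Proof.
have := filter_cat (fun y => lab y == i) (take p w) (drop p w).
rewrite cat_take_drop (drop_nth 0) //= eqxx /letter /block => ->.
by rewrite nth_cat size_filter ltnn subnn.
Qed.

Lemma lt_prefix_count : s i < size (block i).
Proof.
have := leq_prefix_count p.+1 i; rewrite prefix_count_succ /add_letter eqxx.
by [].
Qed.

Lemma lab_nth_lt : i < M.
Proof. by apply: lab_lt; apply: mem_nth. Qed.

(** Otherwise [u] has at least (a + 1)(c - a) inversions, with a = [s i] and c = [size (block i)];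
    this is at least c because a < c, against [few_invs]. *)
Lemma step_s_le i' : i < i' < M -> s i' <= s i.
Proof.
case/andP=> lt_i' _; rewrite leqNgt; apply/negP => lt_s.
have := leq_invs_u p lt_i'; have := few_invs lab_nth_lt; have := lt_prefix_count.
rewrite -/s; nia.
Qed.

(* Otherwise the letters of block [i'] already inserted are inverted by value,
   and the remaining ones by position, with letters of block [i]: at least
   [size (block i')] inversions. *)
Lemma step_val_lt i' j : i' < i -> j < s i' -> j <= s i ->
  letter i' (s i' - j.+1) < letter i (s i - j).
Proof.
move=> lt_i' lt_j le_j.
have lt_si := lt_prefix_count; have le_si' := leq_prefix_count p i'.
have lt_r : s i - j < size (block i) by lia.
have lt_r' : s i' - j.+1 < size (block i') by move: le_si'; rewrite -/s; lia.
rewrite ltnNge leq_eqVlt; apply/norP; split.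
  apply/eqP => e.
  have := mem_nth 0 lt_r; have := mem_nth 0 lt_r'.
  rewrite -/(letter _ _) -/(letter i _) e !mem_filter => /andP[/eqP e1 _] /andP[/eqP e2 _].
  by move: lt_i'; rewrite -e1 e2 ltnn.
apply/negP => lt_val.
have h1 := leq_invs_v lt_i' lt_r lt_r' lt_val.
(* The prefix of length [p.+1] contains [x], so at least one letter of block [i] precedes the
   remaining letters of block [i']. *)
have h2 := leq_invs_u p.+1 lt_i'.
have h3 := few_invs (ltn_trans lt_i' lab_nth_lt).
move: h2; rewrite !prefix_count_succ /add_letter eqxx ifN; last first.
  by rewrite neq_ltn lt_i'.
move: le_si' h1 h3 lt_j le_j lt_si; rewrite -/s.
move: (s i) (s i') (size _) (size (block i)) (invs u) (invs v) => a a' c' c U V.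
clear; move=> le_a' h1 h3 lt_j le_j lt_a h2.
(* Here [c - (a - j)] is at least [j.+1], and [j.+1 * (a' - j)] is at least [a'] because
   [j < a']. *)
have : a' <= (c - (a - j)) * (a' - j.+1).+1.
  apply: (@leq_trans (j.+1 * (a' - j))); first nia.
  by apply: leq_mul; lia.
have : c' - a' <= a.+1 * (c' - a') by rewrite leq_pmull.
lia.
Qed.

Lemma step_val_gt j : j < s i -> letter i (s i - j) < letter i (s i - j.+1).
Proof.
move=> lt_j; have lt_si := lt_prefix_count.
have /(sortedP 0)/(_ (s i - j.+1)) := block_sorted i.
rewrite (_ : (s i - j.+1).+1 = s i - j); last lia.
by apply; lia.
Qed.

(** Otherwise all of block [i'] follows [x], too many inversions of [u]. So every smaller label is
    present in the first row when [x] arrives. *)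
Lemma step_first i' : i' < i -> 0 < s i'.
Proof.
move=> lt_i'; rewrite lt0n; apply/negP => /eqP s0.
have := leq_invs_u p.+1 lt_i'; have := few_invs (ltn_trans lt_i' lab_nth_lt).
rewrite !prefix_count_succ /add_letter eqxx ifN; last by rewrite neq_ltn lt_i'.
rewrite s0; nia.
Qed.

End Step.

(** The invariant of the insertion; the conditions on [H] make it the largest prefix count, so no
    row is empty. *)
Lemma insert_all_take p : p <= n -> exists2 H,
  insert_all (take p w) = [seq block_row M letter (prefix_count p) j | j <- iota 0 H]
  & (forall i, i < M -> prefix_count p i <= H) /\
    (forall j, j < H -> exists2 i, i < M & j < prefix_count p i).
Proof.
elim: p => [|p IH] lt_p.
  by exists 0; rewrite ?take0 //; split=> // i _; rewrite /prefix_count take0.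
have [H eP [le_H gt_H]] := IH (ltnW lt_p).
set x := nth 0 w p; set i := lab x; set s := prefix_count p.
exists (maxn H (s i).+1); last split.
- rewrite (take_nth 0) // insert_all_rcons eP -/x.
  have -> : x = letter i (s i - 0) by rewrite subn0 (val_prefix_count lt_p).
  rewrite (row_insert_block (lab_nth_lt lt_p) (step_val_lt lt_p) (step_s_le lt_p)
     (step_val_gt lt_p)) // subn0.
  by apply: eq_map => j; apply: eq_block_row => i'; rewrite prefix_count_succ.
- move=> i' /le_H; rewrite prefix_count_succ // /add_letter -/x -/i -/s.
  by case: eqP => [->|_]; rewrite leq_max ?leqnn ?orbT // => ->.
- move=> j; rewrite leq_max => /orP[/gt_H[i' lt_i' lt_j]|lt_j].
    exists i' => //; rewrite prefix_count_succ // /add_letter.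
    by case: eqP => // _; rewrite ltnW.
  exists i; first exact: lab_nth_lt.
  by rewrite prefix_count_succ // /add_letter eqxx.
Qed.

(** The first row holds one entry for each smaller label, and the new letter lands just behind
    them. *)
Lemma lab_bump_pos p : p < n ->
  lab (nth 0 w p) = bump_pos (head [::] (insert_all (take p w))) (nth 0 w p).
Proof.
move=> lt_p; have [H eP [le_H gt_H]] := insert_all_take (ltnW lt_p).
set x := nth 0 w p; set i := lab x.
have -> : head [::] (insert_all (take p w)) = block_row M letter (prefix_count p) 0.
  rewrite eP; case: H le_H {eP gt_H} => [|H] // le_0 /=.
  rewrite /block_row filter_iota0 // => i' /andP[_ lt_i'].
  by rewrite -leqNgt le_0.
have := bump_pos_block_row (lab_nth_lt lt_p) (step_val_lt lt_p) (step_s_le lt_p)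
  (step_val_gt lt_p) (leq0n _).
rewrite subn0 (val_prefix_count lt_p) => ->.
rewrite -[LHS](size_iota 0) -count_predT; apply: eq_in_count => i'.
by rewrite mem_iota add0n => /andP[_ lt_i'] /=; rewrite (step_first lt_p lt_i').
Qed.

Lemma shape_insert_all : exists2 H,
  shape (insert_all w)
    = [seq count (fun i => j < size (block i)) (iota 0 M) | j <- iota 0 H]
  & (forall i, i < M -> size (block i) <= H) /\
    (forall j, j < H -> exists2 i, i < M & j < size (block i)).
Proof.
have [H e [le_H gt_H]] := insert_all_take (leqnn n).
have es i : prefix_count n i = size (block i).
  by rewrite size_block /prefix_count take_size.
move: e; rewrite take_size => ->; exists H.
  rewrite /shape -map_comp; apply: eq_map => j /=.
  by rewrite size_map size_filter; apply: eq_count => i; rewrite es.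
split=> [i /le_H|j /gt_H[i lt_i]]; rewrite ?es //.
by exists i.
Qed.

Lemma same_label_gt p q : p < q -> q < n ->
  lab (nth 0 w p) = lab (nth 0 w q) -> nth 0 w q < nth 0 w p.
Proof.
move=> lt_pq lt_q e; have := block_sorted (lab (nth 0 w q)).
have gt_trans : transitive gtn by move=> x y z /=; lia.
rewrite (sorted_pairwise gt_trans) /block.
have := filter_cat (fun x => lab x == lab (nth 0 w q)) (take q w) (drop q w).
rewrite cat_take_drop (drop_nth 0) //= eqxx => ->.
rewrite pairwise_cat => /andP[/allrelP gt_q _].
apply: (gt_q (nth 0 w p)); last by rewrite inE eqxx.
by rewrite mem_filter e eqxx -(nth_take 0 lt_pq) mem_nth // size_take lt_q.
Qed.

Lemma prefix_count_mono p q i : p <= q -> prefix_count p i <= prefix_count q i.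
Proof.
move=> le_pq; rewrite /prefix_count -(subnKC le_pq) takeD count_cat.
exact: leq_addr.
Qed.

(** Otherwise, with [i'] the smaller label, [v] has more inversions than there are letters [i']
    before position [q], and [u] has at least one for each letter [i'] from [q] on: too many in
    total. *)
Lemma larger_label_gt p q : p < q -> q < n ->
  lab (nth 0 w q) < lab (nth 0 w p) -> nth 0 w q < nth 0 w p.
Proof.
move=> lt_pq lt_q lt_lab; have lt_p := ltn_trans lt_pq lt_q.
rewrite ltnNge leq_eqVlt; apply/norP; split.
  by apply: contraTneq lt_lab => ->; rewrite ltnn.
apply/negP => lt_w.
have lt_s := lt_prefix_count lt_p; have lt_s' := lt_prefix_count lt_q.
have h1 := leq_invs_v lt_lab lt_s lt_s'.
rewrite (val_prefix_count lt_p) (val_prefix_count lt_q) in h1.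
have {}h1 := h1 lt_w.
have h2 := leq_invs_u p.+1 lt_lab.
have h3 := few_invs (ltn_trans lt_lab (lab_nth_lt lt_p)).
have := prefix_count_mono (lab (nth 0 w q)) lt_pq.
move: h2; rewrite [prefix_count p.+1 (lab (nth 0 w p))]prefix_count_succ //.
rewrite /add_letter eqxx; nia.
Qed.

(** Pairs with equal labels are inverted, and so are pairs whose labels are inverted by position. In
    the other inversions labels increase along positions; these are exactly the inversions of
    [v]. *)
Lemma invs_labelled :
  invs w = \sum_(i < M) 'C(size (block i), 2) + invs u + invs v.
Proof.
have size_u : size u = n by rewrite size_map.
have size_v : size v = n by rewrite size_map size_iota.
have lab_u (i : 'I_n) : nth 0 u i = lab (nth 0 w i) by rewrite (nth_map 0).
have lab_v (i : 'I_n) : nth 0 v i = lab i.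
  by rewrite (nth_map 0) ?size_iota ?nth_iota.
have -> : \sum_(i < M) 'C(size (block i), 2)
    = \sum_(i < n) \sum_(j < n) ((i < j) && (nth 0 u i == nth 0 u j) : nat).
  rewrite -size_u (@sum_eq_pairs M) => [|_ /mapP[x /lab_lt lt_x ->] //].
  by apply: eq_bigr => i _; rewrite size_block count_map.
rewrite (invs_sum (erefl n)) (invs_sum size_u) (invs_sum size_v).
pose g x y : nat := (y < x) && (lab x < lab y).
have -> : \sum_(i < n) \sum_(j < n) ((i < j) && (nth 0 v j < nth 0 v i) : nat)
    = \sum_(i < n) \sum_(j < n) g (nth 0 w i) (nth 0 w j).
  transitivity (\sum_(x <- w) \sum_(y <- w) g x y).
    rewrite (perm_big _ w_perm) /=.
    under [RHS]eq_bigr do rewrite (perm_big _ w_perm) /=.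
    rewrite -[n]subn0 -/(index_iota 0 n) subn0 big_mkord exchange_big /=.
    apply: eq_bigr => i _; rewrite big_mkord; apply: eq_bigr => j _.
    by rewrite !lab_v /g.
  rewrite (big_nth 0) big_mkord; apply: eq_bigr => i _.
  by rewrite (big_nth 0) big_mkord.
rewrite -!big_split; apply: eq_bigr => i _.
rewrite -!big_split; apply: eq_bigr => j _ /=.
rewrite !lab_u /g.
have [lt_ij|lt_ji|/val_inj->] := ltngtP i j; last by rewrite !ltnn !andbF.
- case: (ltngtP (lab (nth 0 w i))) => [lt_lab|lt_lab|e_lab] /=;
    rewrite ?andbT ?andbF //.
  + by rewrite larger_label_gt.
  + by rewrite same_label_gt.
(* With [j] before [i], [g] would mark labels inverted by position but values in order, excluded by
   [larger_label_gt]. *)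
- rewrite /= !add0n; case: (ltnP (lab (nth 0 w i))) => // lt_lab.
    by rewrite andbT ltnNge ltnW // larger_label_gt.
  by rewrite andbF.
Qed.

End LabelledWord.

(** * Realizing label words; conjugate partitions *)

Lemma labelled_word_exists (lab : nat -> nat) (S u : seq nat) :
  pairwise gtn S -> perm_eq [seq lab x | x <- S] u -> exists w,
  [/\ perm_eq w S, [seq lab x | x <- w] = u
    & forall i, pairwise gtn [seq x <- w | lab x == i]].
Proof.
elim: u S => [|a u IH] S S_gt pS.
  by exists [::]; have := perm_size pS; case: S {pS S_gt}.
have hasS : has (fun x => lab x == a) S.
  by rewrite has_count -(count_map lab (pred1 a)) (seq.permP pS) /= eqxx.
move: S_gt pS; case/split_find: hasS => y S1 S2 /eqP lab_y no_a.
rewrite cat_rcons pairwise_cat allrel_consr /= => /andP[/andP[_ S12]].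
case/and3P=> S1_gt y_S2 S2_gt; rewrite map_cat /= lab_y => pS.
have pS' : perm_eq [seq lab x | x <- S1 ++ S2] u.
  apply/seq.permP => p; have := seq.permP pS p.
  by rewrite map_cat !count_cat /=; lia.
have S'_gt : pairwise gtn (S1 ++ S2) by rewrite pairwise_cat S12 S1_gt.
have [w [w_perm w_u w_gt]] := IH _ S'_gt pS'.
exists (y :: w); split.
- apply/seq.permP => p.
  by rewrite /= (seq.permP w_perm) !count_cat /=; lia.
- by rewrite /= lab_y w_u.
move=> i /=; case: eqP => // e; rewrite /= w_gt andbT; apply/allP => x.
rewrite mem_filter (perm_mem w_perm) mem_cat => /andP[/eqP lab_x /orP[x_S1|]].
  by case/negP: no_a; apply/hasP; exists x => //; rewrite lab_x -e lab_y.
by move/(allP y_S2).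
Qed.

Lemma exists_one_line n w : perm_eq w (iota 0 n) -> exists s : 'S_n, one_line s = w.
Proof.
move=> w_perm; have size_w : size w = n by rewrite (perm_size w_perm) size_iota.
have lt_w (i : 'I_n) : nth 0 w i < n.
  have : nth 0 w i \in w by rewrite mem_nth // size_w.
  by rewrite (perm_mem w_perm) mem_iota.
have inj_w : injective (fun i : 'I_n => Ordinal (lt_w i)).
  move=> i j [] /eqP; rewrite nth_uniq ?size_w //; first by move/eqP/val_inj.
  by rewrite (perm_uniq w_perm) iota_uniq.
exists (perm inj_w); apply: (@eq_from_nth _ 0); rewrite size_one_line ?size_w //.
by move=> i lt_i; rewrite (nth_one_line _ (Ordinal lt_i)) permE.
Qed.

Lemma perm_one_line n (s : 'S_n) : perm_eq (one_line s) (iota 0 n).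
Proof.
rewrite -val_enum_ord /one_line (map_comp val s) perm_map //.
apply: uniq_perm; rewrite ?(map_inj_uniq perm_inj) ?enum_uniq // => i.
rewrite mem_enum inE -[i](permKV s) map_f // mem_enum.
by [].
Qed.

(** A column of length c has row indices 0, ..., c - 1. *)
Lemma weight_columns M H (c : nat -> nat) : (forall i, i < M -> c i <= H) ->
  weight [seq count (fun i => j < c i) (iota 0 M) | j <- iota 0 H]
  = \sum_(i < M) 'C(c i, 2).
Proof.
move=> le_H; rewrite /weight size_map size_iota.
transitivity (\sum_(j < H) \sum_(i < M) if j < c i then (j : nat) else 0).
  apply: eq_bigr => j _; rewrite (nth_map 0) ?size_iota // nth_iota // add0n.
  rewrite -sum1_count big_distrr big_mkcond /= muln1.
  rewrite -(big_mkord xpredT (fun i => if j < c i then (j : nat) else 0)).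
  by rewrite /index_iota subn0.
rewrite exchange_big; apply: eq_bigr => i _ /=.
rewrite -bin2_sum big_mkord (big_ord_widen H id) ?le_H //.
by rewrite [RHS]big_mkcond.
Qed.

(** Both sides say that the cell in row [j] and column [l] lies in the diagram of [la]. *)
Lemma ltn_count_nth la l j : sorted geq la ->
  (j < count (ltn l) la) = (l < nth 0 la j).
Proof.
have ge_trans : transitive geq by move=> x y z /=; lia.
elim: la j => [|x la IH] j; first by rewrite nth_nil.
move=> path_la; have /allP le_x := order_path_min ge_trans path_la.
have {}IH := IH _ (path_sorted path_la).
rewrite /=; case: (ltnP l x) => [lt_l|ge_l].
  by rewrite add1n; case: j => [|j] //=; rewrite ltnS IH.
have lt0 i : (l < nth 0 la i) = false.
  case: (ltnP i (size la)) => [lt_i|ge_i]; last by rewrite nth_default.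
  by have := le_x _ (mem_nth 0 lt_i); rewrite /=; lia.
rewrite add0n IH lt0; case: j => [|j] /=; last by rewrite lt0.
by rewrite ltnNge ge_l.
Qed.

Lemma count_gtn_iota a b : a <= b -> count (gtn a) (iota 0 b) = a.
Proof.
move=> le_ab; rewrite -(subnKC le_ab) iotaD count_cat.
rewrite (eq_in_count (a2 := predT)) ?count_predT ?size_iota; last first.
  by move=> x; rewrite mem_iota.
rewrite (eq_in_count (a2 := pred0)) ?count_pred0 ?addn0 // => x.
by rewrite mem_iota /=; lia.
Qed.

Lemma leq_head la x : sorted geq la -> x \in la -> x <= head 0 la.
Proof.
have ge_trans : transitive geq by move=> y z t /=; lia.
case: la => //= y la path_la; rewrite inE => /predU1P[->//|].
by move: x; apply/allP; exact: order_path_min path_la.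
Qed.

(** Conjugating twice gives [la] back; a count allows the columns to come in any order. *)
Lemma count_conj_partition la j : sorted geq la ->
  count (ltn j) (conj_partition la) = nth 0 la j.
Proof.
move=> la_sorted; rewrite count_map -[RHS](@count_gtn_iota _ (head 0 la)).
  by apply: eq_count => l; rewrite /= ltn_count_nth.
case: (ltnP j (size la)) => [lt_j|ge_j]; last by rewrite nth_default.
by rewrite leq_head // mem_nth.
Qed.

Lemma sumn_conj_partition la : sorted geq la -> sumn (conj_partition la) = sumn la.
Proof.
move=> la_sorted; rewrite !sumnE big_map.
transitivity (\sum_(l <- iota 0 (head 0 la)) \sum_(p <- la) (l < p : nat)).
  apply: eq_bigr => l _; rewrite -sum1_count big_mkcond.
  by apply: eq_bigr => p _; case: ifP.
rewrite exchange_big; apply: eq_big_seq => p p_la /=.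
rewrite -[RHS](@count_gtn_iota _ (head 0 la)) ?leq_head //.
by rewrite -sum1_count [RHS]big_mkcond; apply: eq_bigr => l _; rewrite /=; case: ifP.
Qed.

Lemma eq_from_nth0 (s1 s2 : seq nat) : 0 \notin s1 -> 0 \notin s2 ->
  nth 0 s1 =1 nth 0 s2 -> s1 = s2.
Proof.
have le_size (t1 t2 : seq nat) : 0 \notin t1 -> nth 0 t1 =1 nth 0 t2 ->
    size t1 <= size t2.
  move=> t1_0 e; rewrite leqNgt; apply: contra t1_0 => lt_s.
  by rewrite -(nth_default 0 (leqnn (size t2))) -e mem_nth.
move=> h1 h2 e; apply: (@eq_from_nth _ 0) => [|i _]; last exact: e.
apply/eqP; rewrite eqn_leq !le_size // => i; by rewrite e.
Qed.

(** * Words with prescribed content *)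

(* [g j] copies of the letter [a] are inserted in front of the last [j] letters
   of [s]. *)
Fixpoint shuf (a : nat) (g : nat -> nat) (s : seq nat) : seq nat :=
  nseq (g (size s)) a ++ (if s is x :: s' then x :: shuf a g s' else [::]).

Lemma count_shuf (p : pred nat) a g s :
  count p (shuf a g s) = p a * (\sum_(j < (size s).+1) g j) + count p s.
Proof.
elim: s => [|x s IH].
  by rewrite /= cats0 count_nseq big_ord_recr big_ord0 /= addn0.
rewrite [shuf _ _ _]/= count_cat count_nseq /= IH [in RHS]big_ord_recr /= mulnDr.
by lia.
Qed.

Lemma invs_nseq_cat k a r : invs (nseq k a ++ r) = k * count (gtn a) r + invs r.
Proof.
elim: k => [|k IH] //=; rewrite IH count_cat count_nseq /= ltnn mulSn.
by lia.
Qed.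

(** As [a] exceeds all of [s], a copy in front of the last [j] letters adds just [j] inversions. *)
Lemma invs_shuf a g s : all (ltn^~ a) s ->
  invs (shuf a g s) = invs s + \sum_(j < (size s).+1) j * g j.
Proof.
elim: s => [|x s IH] /=.
  by rewrite invs_nseq_cat big_ord_recr big_ord0 /= muln0.
case/andP=> lt_x lt_s; rewrite invs_nseq_cat /= IH // [in RHS]big_ord_recr /=.
rewrite !count_shuf /= lt_x ltnn ltnNge ltnW // !mul0n !add0n.
have -> : count (gtn a) s = size s by apply/eqP; rewrite -all_count.
by rewrite mulnC; lia.
Qed.

Lemma filter_shuf a g s : all (ltn^~ a) s -> [seq x <- shuf a g s | x != a] = s.
Proof.
have filter_nseq k : [seq x <- nseq k a | x != a] = [::].
  by elim: k => //= k ->; rewrite eqxx.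
elim: s => [|x s IH] /=; first by rewrite cats0.
case/andP=> lt_x lt_s; rewrite filter_cat filter_nseq /= IH //.
by rewrite neq_ltn lt_x.
Qed.

(** The values of [g] are the lengths of the runs of [a] around the letters of [s]. *)
Lemma shuf_inj a g g' s : all (ltn^~ a) s -> shuf a g s = shuf a g' s ->
  forall j, j <= size s -> g j = g' j.
Proof.
have nseq_inj k k' x (r r' : seq nat) : x != a ->
    nseq k a ++ x :: r = nseq k' a ++ x :: r' -> k = k' /\ r = r'.
  move=> ne_xa; elim: k k' => [|k IH] [|k'] //=.
  - by case.
  - by case=> /eqP; rewrite (negPf ne_xa).
  - by case=> /esym/eqP; rewrite (negPf ne_xa).
  - by case=> /IH[-> ->].
elim: s => [|x s IH] /=.
  move=> _; rewrite !cats0 => /(congr1 size); rewrite !size_nseq => e0 j.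
  by rewrite leqn0 => /eqP->.
case/andP=> lt_x lt_s /nseq_inj[|eg /(IH lt_s) e j]; first by rewrite neq_ltn lt_x.
by rewrite leq_eqVlt => /predU1P[->|] //; apply: e.
Qed.

(** Letters enter in increasing order, so that each exceeds all those present. *)
Fixpoint shuf_word (g : nat -> nat -> nat) (N : nat) : seq nat :=
  if N is N'.+1 then shuf N' (g N') (shuf_word g N') else [::].

Lemma shuf_word_lt g N : all (ltn^~ N) (shuf_word g N).
Proof.
elim: N => //= N IH; rewrite all_count; apply/eqP.
rewrite count_shuf /= ltnS leqnn mul1n -[in RHS]count_predT count_shuf mul1n.
congr (_ + _); rewrite count_predT; apply/eqP; rewrite -all_count.
by apply: sub_all IH => x /= /leqW.
Qed.

(** Deleting the largest letter recovers the word on the smaller ones; the run lengths then recover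
    [g] at that letter. *)
Lemma shuf_word_inj g g' N : shuf_word g N = shuf_word g' N ->
  forall i j, i < N -> j <= size (shuf_word g i) -> g i j = g' i j.
Proof.
elim: N => //= N IH eN.
have e : shuf_word g N = shuf_word g' N.
  rewrite -(filter_shuf (g N) (shuf_word_lt g N)) eN.
  by rewrite filter_shuf // shuf_word_lt.
move=> i j; rewrite ltnS leq_eqVlt => /predU1P[->|lt_i]; last exact: IH.
by move: j; apply: shuf_inj (shuf_word_lt g N) _; rewrite eN e.
Qed.

Lemma sum_ord_ext0 (F : nat -> nat) a b : (forall j, minn a b <= j -> F j = 0) ->
  \sum_(j < a) F j = \sum_(j < b) F j.
Proof.
have main a' b' : a' <= b' -> (forall j, a' <= j -> F j = 0) ->
    \sum_(j < a') F j = \sum_(j < b') F j.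
  move=> le_ab F0; rewrite (big_ord_widen b' F le_ab) big_mkcond.
  by apply: eq_bigr => j _; case: ltnP => // /F0.
case: (leqP a b) => [le_ab|/ltnW le_ba] F0; first exact: main.
by rewrite [RHS](main b a).
Qed.

Section ContentWord.

(* A word with [c i] letters [i < M]: exactly [e i l] of the letters [i] are
   followed by [l.+1] smaller letters, the others by none. *)
Variables (M D : nat) (c : nat -> nat) (e : nat -> nat -> nat).
Hypothesis e0 : forall l, e 0 l = 0.
Hypothesis e_max : forall i l, D <= l -> e i l = 0.
Hypothesis lt_c : forall i, i < M -> D < c i.
Hypothesis e_sum : \sum_(i < M) \sum_(l < D) l.+1 * e i l <= D.

(** Index 0 absorbs the copies that [e] leaves over; for [i < M] the subtraction is not truncated,
    as [sum_letter_mult] shows. *)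
Definition letter_mult i j : nat :=
  if j is l.+1 then e i l else c i - \sum_(l < D) e i l.

Definition content_word : seq nat := shuf_word letter_mult M.

Lemma sum_letter_mult i : i < M -> \sum_(j < D.+1) letter_mult i j = c i.
Proof.
move=> lt_i; rewrite big_ord_recl /= subnK //.
apply: leq_trans (ltnW (lt_c lt_i)); apply: leq_trans e_sum.
rewrite [leqRHS](bigD1 (Ordinal lt_i)) //=; apply: leq_trans (leq_addr _ _).
by apply: leq_sum => l _; rewrite leq_pmull.
Qed.

(** The length bound joins the induction because a letter can precede [l.+1] smaller ones only if so
    many are present; for letter 0, [e0] replaces it. *)
Lemma count_shuf_word N i : N <= M ->
  (count_mem i (shuf_word letter_mult N) = if i < N then c i else 0)
  /\ (0 < N -> D <= size (shuf_word letter_mult N)).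
Proof.
elim: N i => [|N IH] i le_N //; have [IHc IHs] := IH i (ltnW le_N).
have sum_g : \sum_(j < (size (shuf_word letter_mult N)).+1) letter_mult N j = c N.
  rewrite -(sum_letter_mult le_N); apply: sum_ord_ext0 => -[|j] //=.
    by rewrite geq_min.
  rewrite geq_min !ltnS => le_j.
  case: N {IH IHc le_N} IHs le_j => [|N] IHs le_j //; rewrite e_max //.
  by case/orP: le_j => // le_j; apply: leq_trans (IHs _) le_j.
split=> [|_]; last first.
  rewrite -count_predT /= count_shuf sum_g /= mul1n.
  by apply: leq_trans (leq_addr _ _); rewrite ltnW // lt_c.
rewrite /= count_shuf sum_g IHc /= ltnS eq_sym.
by case: ltngtP => [lt_i|lt_i|->]; rewrite ?mul0n ?mul1n ?addn0.
Qed.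

Lemma size_shuf_word N : 0 < N <= M -> D <= size (shuf_word letter_mult N).
Proof. by case/andP=> N0 le_N; apply: (count_shuf_word 0 le_N).2. Qed.

Lemma count_content_word i : i < M -> count_mem i content_word = c i.
Proof. by move=> lt_i; rewrite (count_shuf_word i (leqnn M)).1 lt_i. Qed.

Lemma content_word_lt : all (ltn^~ M) content_word.
Proof. exact: shuf_word_lt. Qed.

Lemma invs_content_word :
  invs content_word = \sum_(i < M) \sum_(l < D) l.+1 * e i l.
Proof.
suff invs_shuf_word N : N <= M ->
    invs (shuf_word letter_mult N) = \sum_(i < N) \sum_(l < D) l.+1 * e i l.
  exact: invs_shuf_word.
elim: N => [|N IH] le_N /=.
  by rewrite big_ord0.
rewrite invs_shuf ?shuf_word_lt // IH ?(ltnW le_N) // [in RHS]big_ord_recr /=.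
congr (_ + _); transitivity (\sum_(j < D.+1) j * letter_mult N j).
  apply: (sum_ord_ext0 (F := fun j => j * letter_mult N j)) => -[|j] //=.
  rewrite geq_min !ltnS => le_j.
  case: N {IH} le_N le_j => [|N] le_N le_j; first by rewrite e0 muln0.
  rewrite e_max ?muln0 //; case/orP: le_j => // le_j.
  by apply: (leq_trans _ le_j); apply: size_shuf_word; exact: ltnW.
by rewrite big_ord_recl mul0n.
Qed.

End ContentWord.

Lemma content_word_inj M D c e e' :
  (forall l, e 0 l = 0) -> (forall i l, D <= l -> e i l = 0) ->
  (forall i, i < M -> D < c i) ->
  \sum_(i < M) \sum_(l < D) l.+1 * e i l <= D ->
  (forall l, e' 0 l = 0) ->
  content_word M D c e = content_word M D c e' ->
  forall i l, i < M -> l < D -> e i l = e' i l.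
Proof.
move=> e0 e_max lt_c e_sum e'0 /shuf_word_inj eq_g [|i] l lt_i lt_l.
  by rewrite e0 e'0.
apply: (eq_g i.+1 l.+1) => //; apply: leq_trans lt_l _.
by apply: (size_shuf_word (M := M)) => //; exact: ltnW.
Qed.

(** * Multinomial coefficients and counting by a relation *)

Section Arrangements.

Variable k : nat.

(* The words with [m i] letters [i], provided their length [N] is the sum of [m]. *)
Fixpoint arrangements (N : nat) (m : 'I_k -> nat) : seq (seq 'I_k) :=
  if N is N'.+1 then
    [seq x :: r | x <- [seq x <- enum 'I_k | 0 < m x],
                  r <- arrangements N' (fun i => m i - (i == x))]
  else [:: [::]].

Lemma sum_remove (m : 'I_k -> nat) x : 0 < m x ->
  (\sum_i (m i - (i == x))).+1 = \sum_i m i.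
Proof.
move=> m_x; rewrite (bigD1 x) //= [RHS](bigD1 x) //= eqxx subn1 -addSn prednK //.
by congr (_ + _); apply: eq_bigr => i /negPf->; rewrite subn0.
Qed.

Lemma arrangementsP N (m : 'I_k -> nat) r : \sum_i m i = N ->
  r \in arrangements N m -> size r = N /\ forall i, count_mem i r = m i.
Proof.
elim: N m r => [|N IH] m r /= sum_m.
  rewrite inE => /eqP->; split=> // i.
  by move: sum_m; rewrite (bigD1 i) //= => /eqP; rewrite addn_eq0 => /andP[/eqP->].
case/allpairsPdep=> x [r' [+ r'_in ->]]; rewrite mem_filter => /andP[m_x _].
have [|size_r count_r] := IH _ r' _ r'_in.
  by apply: succn_inj; rewrite sum_remove.
split=> [|i]; first by rewrite /= size_r.
rewrite /= count_r eq_sym; case: eqP => [->|_]; last by rewrite subn0.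
by rewrite subnKC.
Qed.

Lemma arrangements_uniq N (m : 'I_k -> nat) : uniq (arrangements N m).
Proof.
elim: N m => //= N IH m; apply: allpairs_uniq_dep => //.
  by rewrite filter_uniq ?enum_uniq.
by move=> [x r] [y r'] _ _ /= [-> ->].
Qed.

(** Split by the first letter [x]: it contributes m x times the factorial of the remaining
    length. *)
Lemma size_arrangements N (m : 'I_k -> nat) : \sum_i m i = N ->
  size (arrangements N m) * \prod_i (m i)`! = N`!.
Proof.
elim: N m => [|N IH] m sum_m.
  rewrite big1 // => i _.
  by move: sum_m; rewrite (bigD1 i) //= => /eqP; rewrite addn_eq0 => /andP[/eqP->].
rewrite /= size_allpairs_dep sumnE big_map big_filter big_distrl /= big_enum_cond /=.
rewrite (eq_bigr (fun x => m x * N`!)) => [|x m_x].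
  rewrite -big_distrl /= big_mkcond factS -sum_m; congr (_ * _).
  by apply: eq_bigr => x _; case: (m x).
rewrite -(IH (fun i => m i - (i == x))); last first.
  by apply: succn_inj; rewrite sum_remove.
rewrite mulnCA; congr (_ * _).
rewrite (bigD1 x) //= [in RHS](bigD1 x) //= eqxx mulnA subn1.
rewrite (_ : (m x)`! = m x * (m x).-1`!); last by case: (m x) m_x.
by congr (_ * _); apply: eq_bigr => i /negPf->; rewrite subn0.
Qed.

Lemma multinomialE (m : 'I_k -> nat) :
  multinomial m = size (arrangements (\sum_i m i) m).
Proof.
rewrite /multinomial -(size_arrangements (erefl _)) mulnK //.
by apply/prodn_gt0 => i; apply: fact_gt0.
Qed.

End Arrangements.

(** A relation replaces an injective function, since permutations with given labels are only known
    to exist. *)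
Lemma leq_size_card (T : eqType) (S : finType) (X : seq T) (A : {set S})
    (R : T -> S -> Prop) : uniq X ->
  (forall x, x \in X -> exists2 y, y \in A & R x y) ->
  (forall x x' y, x \in X -> x' \in X -> R x y -> R x' y -> x = x') ->
  size X <= #|A|.
Proof.
move=> uniqX exR injR.
suff [Y [<- uniqY YA _]] : exists Y : seq S, [/\ size Y = size X, uniq Y,
    {subset Y <= A} & forall y, y \in Y -> exists2 x, x \in X & R x y].
  by rewrite cardE uniq_leq_size // => y /YA; rewrite mem_enum.
elim: X uniqX exR injR => [|x X IH] /=; first by exists [::].
case/andP=> x_X uniqX exR injR.
have [||Y [size_Y uniqY YA YX]] := IH uniqX.
- by move=> z z_X; apply: exR; rewrite inE z_X orbT.
- by move=> z z' y z_X z'_X; apply: injR; rewrite inE ?z_X ?z'_X orbT.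
have [|y y_A Rxy] := exR x; first by rewrite inE eqxx.
exists (y :: Y); split=> /=; first by rewrite size_Y.
- rewrite uniqY andbT; apply: contra x_X => /YX[z z_X Rzy].
  by rewrite (injR x z y) // inE ?eqxx // z_X orbT.
- by move=> z; rewrite inE => /predU1P[->|/YA].
move=> z; rewrite inE => /predU1P[->|/YX[z' z'_X Rz]].
  by exists x; rewrite ?inE ?eqxx.
by exists z' => //; rewrite inE z'_X orbT.
Qed.

(** * Labellings of permutations *)

(* [V] lists the labels of the values [0, ..., n-1]; each class of labels is a
   decreasing subsequence of [s]. *)
Definition labelling M n (s : 'S_n) (U V : seq nat) : Prop :=
  [/\ size V = n, all (ltn^~ M) V, [seq nth 0 V x | x <- one_line s] = U,
      forall i, sorted gtn (block (nth 0 V) (one_line s) i)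
    & forall i, i < M -> invs U + invs V < count_mem i V].

Section Labelling.

Variables (M n : nat) (s : 'S_n) (U V : seq nat).
Hypothesis UV : labelling M s U V.

Let lab := nth 0 V.
Let w := one_line s.

Lemma labelling_perm : perm_eq w (iota 0 (size w)).
Proof. by rewrite size_one_line perm_one_line. Qed.

Lemma labelling_values : [seq lab x | x <- iota 0 (size w)] = V.
Proof.
have [size_V _ _ _ _] := UV; rewrite size_one_line -[in iota 0 _]size_V.
exact: mkseq_nth.
Qed.

Lemma labelling_lt x : x \in w -> lab x < M.
Proof.
have [size_V lt_V _ _ _] := UV; rewrite (perm_mem labelling_perm) mem_iota.
rewrite size_one_line -[in X in _ < X]size_V => /andP[_ lt_x].
by have /allP := lt_V; apply; apply: mem_nth.
Qed.

Lemma labelling_size_block i : size (block lab w i) = count_mem i V.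
Proof.
by rewrite size_filter (seq.permP labelling_perm) -[in RHS]labelling_values count_map.
Qed.

Lemma labelling_sorted i : sorted gtn (block lab w i).
Proof. by have [_ _ _ + _] := UV; apply. Qed.

Lemma labelling_few i : i < M ->
  invs [seq lab x | x <- w] + invs [seq lab x | x <- iota 0 (size w)]
    < size (block lab w i).
Proof.
have [_ _ eU _ few] := UV.
by rewrite labelling_values labelling_size_block eU; apply: few.
Qed.

Lemma labelling_bump p : p < n ->
  nth 0 U p = bump_pos (head [::] (insert_all (take p w))) (nth 0 w p).
Proof.
have [_ _ <- _ _] := UV; move=> lt_p; rewrite (nth_map 0) ?size_one_line //.
apply: (lab_bump_pos labelling_perm labelling_lt labelling_sorted labelling_few).
by rewrite size_one_line.
Qed.

Lemma nth_sh_labelling : 0 \notin sh s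
  /\ forall j, nth 0 (sh s) j = count (fun i => j < count_mem i V) (iota 0 M).
Proof.
have [H eH [le_H gt_H]] := shape_insert_all labelling_perm labelling_lt
  labelling_sorted labelling_few.
rewrite /sh /insertion_tableau robinson_schensted1 -/w eH; split.
  apply/mapP => -[j]; rewrite mem_iota add0n => /andP[_ /gt_H[i lt_i lt_j]] e.
  suff: has (fun i => j < size (block lab w i)) (iota 0 M) by rewrite has_count -e.
  by apply/hasP; exists i; rewrite ?mem_iota.
move=> j; case: (ltnP j H) => [lt_j|ge_j].
  rewrite (nth_map 0) ?size_iota // nth_iota // add0n.
  by apply: eq_count => i; rewrite labelling_size_block.
rewrite nth_default ?size_map ?size_iota //; apply/esym/eqP.
rewrite -leqn0 leqNgt -has_count; apply/hasPn => i; rewrite mem_iota => lt_i.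
by rewrite -leqNgt -labelling_size_block (leq_trans (le_H i _)).
Qed.

Lemma inv_labelling : Defs.inv s = weight (sh s) + (invs U + invs V).
Proof.
have [_ _ eU _ _] := UV.
rewrite inv_one_line (invs_labelled labelling_perm labelling_lt labelling_sorted
  labelling_few) labelling_values eU -addnA; congr (_ + _).
have [H eH [le_H _]] := shape_insert_all labelling_perm labelling_lt
  labelling_sorted labelling_few.
by rewrite /sh /insertion_tableau robinson_schensted1 -/w eH weight_columns.
Qed.

End Labelling.

(** [U] consists of bump positions in the first row, which depend on [s] alone; [s] then carries the
    labels from positions to values. *)
Lemma labelling_unique M n (s : 'S_n) U V U' V' :
  labelling M s U V -> labelling M s U' V' -> U = U' /\ V = V'.
Proof.
move=> UV UV'; have [size_V _ eU _ _] := UV; have [size_V' _ eU' _ _] := UV'.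
have e : U = U'.
  apply: (@eq_from_nth _ 0) => [|p]; first by rewrite -eU -eU' !size_map.
  rewrite -eU size_map size_one_line eU => lt_p.
  by rewrite (labelling_bump UV lt_p) (labelling_bump UV' lt_p).
split=> //; apply: (@eq_from_nth _ 0) => [|x]; first by rewrite size_V.
rewrite size_V => lt_x.
have : x \in one_line s by rewrite (perm_mem (perm_one_line s)) mem_iota.
by move: x {lt_x}; apply/eq_in_map; rewrite eU eU'.
Qed.

Lemma labelling_exists M n U V : size V = n -> perm_eq U V -> all (ltn^~ M) V ->
  (forall i, i < M -> invs U + invs V < count_mem i V) ->
  exists s : 'S_n, labelling M s U V.
Proof.
move=> size_V pUV lt_V few.
have gt_trans : transitive gtn by move=> x y z /=; lia.
(* The values are listed in decreasing order, as the greedy choice requires. *)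
have [||w [w_perm w_U w_gt]] := @labelled_word_exists (nth 0 V) (rev (iota 0 n)) U.
- by rewrite -(sorted_pairwise gt_trans) rev_sorted; apply: iota_ltn_sorted.
- by rewrite map_rev perm_rev perm_sym -size_V [X in perm_eq _ X]mkseq_nth.
have [|s s_w] := @exists_one_line n w.
  by apply: perm_trans w_perm _; rewrite perm_rev.
exists s; split; rewrite ?s_w // => i.
by rewrite (sorted_pairwise gt_trans); apply: w_gt.
Qed.

(** * Coloured partitions as data for two label words *)

(* The multiplicity of the part [j.+1] with colour [col]. *)
Definition part_mult C N (f : {ffun 'I_C * 'I_N -> 'I_N.+1}) (col j : nat) : nat :=
  \sum_(x : 'I_C * 'I_N | (x.1 == col :> nat) && (x.2 == j :> nat)) f x.

Lemma part_multE C N (f : {ffun 'I_C * 'I_N -> 'I_N.+1}) (x : 'I_C * 'I_N) :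
  part_mult f x.1 x.2 = f x.
Proof.
by rewrite /part_mult (big_pred1 x) // => y.
Qed.

(* The colours [off, off + 1, ...] prescribe the multiplicities of the letters
   [1, 2, ...]. *)
Definition letter_parts C N (f : {ffun 'I_C * 'I_N -> 'I_N.+1}) off i l : nat :=
  if i is i'.+1 then part_mult f (off + i') l else 0.

Lemma letter_parts_max C N (f : {ffun 'I_C * 'I_N -> 'I_N.+1}) off i l :
  N <= l -> letter_parts f off i l = 0.
Proof.
case: i => //= i le_l; rewrite /part_mult big1 // => x /andP[_ /eqP e].
by have := ltn_ord x.2; rewrite e ltnNge le_l.
Qed.

Definition parts_size C N (f : {ffun 'I_C * 'I_N -> 'I_N.+1}) off P :=
  \sum_(i < P.+1) \sum_(l < N) l.+1 * letter_parts f off i l.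

(** The first [P] colours serve the word of positions, the last [P] the word of values. *)
Lemma sum_parts_size P N (f : {ffun 'I_(2 * P) * 'I_N -> 'I_N.+1}) :
  parts_size f 0 P + parts_size f P P = \sum_(x : 'I_(2 * P) * 'I_N) x.2.+1 * f x.
Proof.
pose G col := \sum_(l < N) l.+1 * part_mult f col l.
have eG off : parts_size f off P = \sum_(i < P) G (off + i).
  rewrite /parts_size big_ord_recl big1 ?add0n // => l _.
  by rewrite muln0.
rewrite !eG -(big_mkord xpredT (fun i => G (0 + i))).
rewrite -(big_mkord xpredT (fun i => G (P + i))).
transitivity (\sum_(0 <= i < 2 * P) G i).
  rewrite [RHS](@big_cat_nat _ _ _ P) //=; last by rewrite leq_pmull.
  congr (_ + _); rewrite -[in index_iota P _](add0n P) big_addn mul2n -addnn addnK.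
  by apply: eq_bigr => i _; rewrite addnC.
rewrite big_mkord pair_big /=; apply: eq_bigr => x _.
by rewrite part_multE.
Qed.

Lemma perm_freq_partition k (t m : 'I_k -> nat) (a : seq 'I_k) :
  (forall i, count_mem i a = m i) -> perm_eq (freq_partition t m) [seq t x | x <- a].
Proof.
move=> count_a.
have -> : freq_partition t m
    = [seq t x | x <- flatten [seq nseq (m i) i | i <- enum 'I_k]].
  rewrite /freq_partition map_flatten -map_comp; congr flatten.
  by apply: eq_map => i; rewrite /= map_nseq.
apply: perm_map; apply/allP => x _ /=; apply/eqP.
rewrite count_a count_flatten sumnE !big_map -enumT big_enum.
rewrite (bigD1 x) //= big1 ?addn0.
  by rewrite count_nseq /= eqxx mul1n.
by move=> i /negPf ne_ix; rewrite count_nseq /= ne_ix.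
Qed.

Lemma perm_words M (c : nat -> nat) (U V : seq nat) :
  all (ltn^~ M) U -> all (ltn^~ M) V ->
  (forall i, i < M -> count_mem i U = c i) ->
  (forall i, i < M -> count_mem i V = c i) -> perm_eq U V.
Proof.
move=> /allP lt_U /allP lt_V cU cV; apply/allP => x; rewrite mem_cat => xUV.
suff lt_x : x < M by rewrite /= cU // cV.
by case/orP: xUV => [/lt_U|/lt_V].
Qed.

Lemma size_word M (c : nat -> nat) (U : seq nat) : all (ltn^~ M) U ->
  (forall i, i < M -> count_mem i U = c i) ->
  size U = sumn [seq c i | i <- iota 0 M].
Proof.
move=> lt_U cU.
rewrite (@perm_size _ _ (flatten [seq nseq (c i) i | i <- iota 0 M])).
  rewrite size_flatten /shape -map_comp; congr sumn.
  by apply: eq_map => i; rewrite /= size_nseq.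
apply: (perm_words (c := c) lt_U) => // [|i lt_i].
  apply/allP => x /flattenP[_ /mapP[i + ->]]; rewrite mem_iota => lt_i.
  by rewrite mem_nseq => /andP[_ /eqP->].
rewrite count_flatten sumnE !big_map (bigD1_seq i) ?iota_uniq ?mem_iota //=.
rewrite count_nseq /= eqxx mul1n big1 ?addn0 // => j /negPf ne_ji.
by rewrite count_nseq /= ne_ji.
Qed.

Theorem theorem3 (n : nat) (la : seq nat) (k : nat) (t m : 'I_k.+1 -> nat)
    (Delta : nat)
    (la_part : is_partition la n)
    (t_decr : forall i j : 'I_k.+1, i < j -> t j < t i)
    (t_pos : 0 < t ord_max)
    (m_pos : forall i : 'I_k.+1, 0 < m i)
    (la_conj : conj_partition la = freq_partition t m)
    (Delta_lt : Delta < t ord_max) :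
  let M := \sum_i m i in
  coloured_partitions (2 * (M - 1)) Delta * multinomial m
    <= #|Wdelta n la Delta|.
Proof.
cbv zeta; set M := \sum_i m i; have [la_sorted la0 la_sum] := and3P la_part.
have M_gt0 : 0 < M by rewrite /M (bigD1 ord0) //= addn_gt0 m_pos.
(* Letter 0 has no smaller letters, so a word on [M] letters takes only [P] colours. *)
rewrite subn1; set P := M.-1; have M_P : M = P.+1 by rewrite prednK.
have t_inj : injective t.
  move=> i j eq_t; apply: val_inj; case: (ltngtP i j) => // /t_decr.
    by rewrite eq_t ltnn.
  by rewrite eq_t ltnn.
have t_min i : t ord_max <= t i.
  have := leq_ord i; rewrite leq_eqVlt => /orP[/eqP e|/(t_decr i ord_max)/ltnW//].
  by rewrite (_ : i = ord_max) //; apply: val_inj.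
(* [c a i] is the length of column [i] when the columns come in the order given by [a]. *)
pose c (a : seq 'I_k.+1) i := nth 0 [seq t x | x <- a] i.
have c_a (a : seq 'I_k.+1) : size a = M ->
    [seq c a i | i <- iota 0 M] = [seq t x | x <- a].
  by move=> size_a; rewrite /c -size_a -(size_map t) [LHS]mkseq_nth.
have lt_c (a : seq 'I_k.+1) i : size a = M -> i < M -> Delta < c a i.
  move=> size_a lt_i; rewrite /c (nth_map ord0) ?size_a //.
  exact: leq_trans Delta_lt (t_min _).
have realize (a : seq 'I_k.+1) U V : size a = M -> (forall i, count_mem i a = m i) ->
    all (ltn^~ M) U -> all (ltn^~ M) V ->
    (forall i, i < M -> count_mem i U = c a i) ->
    (forall i, i < M -> count_mem i V = c a i) -> invs U + invs V <= Delta ->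
    exists s : 'S_n, [/\ labelling M s U V, sh s = la
      & Defs.inv s = weight la + (invs U + invs V)].
  move=> size_a count_a lt_U lt_V cU cV le_UV.
  have perm_a := perm_freq_partition t count_a.
  have size_V : size V = n.
    rewrite (size_word lt_V cV) c_a // -(eqP la_sum) -(sumn_conj_partition la_sorted).
    by rewrite la_conj; apply/esym/perm_sumn.
  have few i : i < M -> invs U + invs V < count_mem i V.
    by move=> lt_i; rewrite cV // (leq_ltn_trans le_UV) // lt_c.
  have [s UV] := labelling_exists size_V (perm_words lt_U lt_V cU cV) lt_V few.
  have sh_s : sh s = la.
    have [sh0 nth_sh] := nth_sh_labelling UV.
    apply: eq_from_nth0 => // j; rewrite nth_sh -count_conj_partition // la_conj.
    rewrite (seq.permP perm_a) -c_a // count_map; apply: eq_in_count => i /=.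
    by rewrite mem_iota => lt_i; rewrite cV.
  by exists s; split=> //; rewrite (inv_labelling UV) sh_s.
pose ft := {ffun 'I_(2 * P) * 'I_Delta -> 'I_Delta.+1}.
pose word (a : seq 'I_k.+1) (f : ft) off :=
  content_word M Delta (c a) (letter_parts f off).
pose fs := [set f : ft | \sum_(x : 'I_(2 * P) * 'I_Delta) x.2.+1 * f x == Delta].
have parts_sum f : f \in fs -> parts_size f 0 P + parts_size f P P = Delta.
  by rewrite inE sum_parts_size => /eqP.
have word_props (a : seq 'I_k.+1) (f : ft) off : size a = M ->
    parts_size f off P <= Delta ->
    [/\ all (ltn^~ M) (word a f off),
        forall i, i < M -> count_mem i (word a f off) = c a i
      & invs (word a f off) = parts_size f off P].
  move=> size_a; rewrite /parts_size -M_P => le_parts.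
  have lt_ca i := lt_c a i size_a.
  have max_f i l := @letter_parts_max _ _ f off i l.
  split; first exact: content_word_lt.
    by move=> i; apply: count_content_word.
  exact: invs_content_word.
have word_inj (a : seq 'I_k.+1) (f f' : ft) off : size a = M ->
    parts_size f off P <= Delta -> word a f off = word a f' off ->
    forall i l, i < P -> l < Delta ->
    part_mult f (off + i) l = part_mult f' (off + i) l.
  move=> size_a; rewrite /parts_size -M_P => le_parts eq_word i l lt_i.
  have lt_ca i' := lt_c a i' size_a.
  have max_f i' l' := @letter_parts_max _ _ f off i' l'.
  apply: (content_word_inj _ max_f lt_ca le_parts _ eq_word (i := i.+1)) => //.
  by rewrite M_P.
have -> : coloured_partitions (2 * P) Delta * multinomial m
    = size [seq (a, f) | a <- arrangements M m, f <- enum fs].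
  by rewrite size_allpairs -cardE mulnC multinomialE.
apply: (@leq_size_card _ _ _ _
  (fun af s => labelling M s (word af.1 af.2 0) (word af.1 af.2 P))).
- by rewrite allpairs_uniq ?arrangements_uniq ?enum_uniq // => -[? ?] [].
- move=> _ /allpairsP[[a f] /= [/arrangementsP[//|size_a count_a] + ->]].
  rewrite mem_enum => /parts_sum sum_f.
  have [|lt_U cU invs_U] := word_props a f 0 size_a.
    by rewrite -[leqRHS]sum_f leq_addr.
  have [|lt_V cV invs_V] := word_props a f P size_a.
    by rewrite -[leqRHS]sum_f leq_addl.
  have invs_UV : invs (word a f 0) + invs (word a f P) = Delta by rewrite invs_U invs_V.
  have [|s [UV sh_s inv_s]] := realize a _ _ size_a count_a lt_U lt_V cU cV.
    by rewrite invs_UV.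
  exists s => //.
  (* The zero table yields a word without inversions; used for both positions and values it gives
     [s0] with [weight la] inversions, the minimum by [weight_le_invs]. *)
  pose f0 : ft := [ffun=> ord0].
  have parts0 off : parts_size f0 off P = 0.
    rewrite /parts_size big1 // => i _; rewrite big1 // => l _.
    case: i => [[|i] lt_i] /=; rewrite ?muln0 // /part_mult big1 ?muln0 // => x _.
    by rewrite ffunE.
  have [|lt_0 c0 invs_0] := word_props a f0 0 size_a; first by rewrite parts0.
  have [|s0 [_ sh_s0 inv_s0]] := realize a _ _ size_a count_a lt_0 lt_0 c0 c0.
    by rewrite invs_0 parts0.
  rewrite inE inE sh_s eqxx /=; apply/existsP; exists s0.
  rewrite inE sh_s0 eqxx /=; apply/andP; split.
    apply/forallP => s1; apply/implyP; rewrite inE => /eqP sh_s1.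
    rewrite inv_s0 invs_0 parts0 !addn0 -sh_s1 /sh /insertion_tableau.
    by rewrite robinson_schensted1 inv_one_line weight_le_invs.
  by rewrite inv_s inv_s0 invs_UV invs_0 parts0 !addn0.
move=> x x' s /allpairsP[[a f] /= [/arrangementsP[//|size_a _] + ->]].
rewrite mem_enum => /parts_sum sum_f.
move=> /allpairsP[[a' f'] /= [/arrangementsP[//|size_a' _] + ->]].
rewrite mem_enum => /parts_sum sum_f' UV UV' /=.
have [eU eV] := labelling_unique UV UV'.
have le_f0 : parts_size f 0 P <= Delta by rewrite -[leqRHS]sum_f leq_addr.
have le_fP : parts_size f P P <= Delta by rewrite -[leqRHS]sum_f leq_addl.
have le_f'0 : parts_size f' 0 P <= Delta by rewrite -[leqRHS]sum_f' leq_addr.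
(* The letter counts of the position word are the column lengths in order, and [t] is injective. *)
have eq_a : a = a'.
  have [_ cU _] := word_props a f 0 size_a le_f0.
  have [_ cU' _] := word_props a' f' 0 size_a' le_f'0.
  apply: (inj_map t_inj); rewrite -!c_a //; apply/eq_in_map => i.
  by rewrite mem_iota => lt_i; rewrite -cU // eU cU'.
move: eU eV; rewrite -eq_a => eU eV; congr (_, _).
apply/ffunP => -[col l]; apply: val_inj.
rewrite /= -(part_multE f (col, l)) -(part_multE f' (col, l)) /=.
(* Colours below [P] are recovered from the position word, the others from the value word. *)
case: (ltnP col P) => [lt_col|ge_col].
  by rewrite -[val col]add0n (word_inj a f f').
rewrite -(subnKC ge_col) (word_inj a f f') //.
by have := ltn_ord col; lia.
Qed.
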